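(* Let $d,r\ge1$ be integers and $\alpha_1,\dots,\alpha_r\in\mathbb{R}^d$. Let $\xi_1,\dots,\xi_r$ be $\mathbb{Z}$-valued random variables and $I$ a $\{1,2,\dots,r\}$-valued random variable such that $\xi_1,\dots,\xi_r,I$ are independent, and let $\nu$ be the distribution of $\xi_I\alpha_I+\mathbb{Z}^d$ on $\mathbb{R}^d/\mathbb{Z}^d$, i.e. $$\nu=\sum_{i=1}^r\sum_{n\in\mathbb{Z}}\Pr(I=i)\Pr(\xi_i=n)\,\delta_{n\alpha_i+\mathbb{Z}^d}.$$ Let $\mu$ be the normalized Haar measure on $\mathbb{R}^d/\mathbb{Z}^d$. Assume that $\Pr(I=i)\,\mathbb{E}\xi_i^2\le B$ for all $1\le i\le r$ with some constant $B>0$. If the system of vectors $\alpha_1,\dots,\alpha_r$ is badly approximable, then there is a constant $c>0$, depending only on $\alpha_1,\dots,\alpha_r$ and $B$, such that for any $0<p\le1$ and any integer $k\ge1$, $$W_p(\nu^{*k},\mu)^{1/p}\ge c\,k^{-r/(2d)}.$$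
   Context: $\|\cdot\|_{\mathbb{R}/\mathbb{Z}}$ is the distance to the nearest integer; $\|h\|_\infty=\max_j|h_j|$; $\langle\cdot,\cdot\rangle$ is the usual scalar product on $\mathbb{R}^d$; $\delta_a$ is the Dirac measure at $a$. The system $\alpha_1,\dots,\alpha_r\in\mathbb{R}^d$ is called badly approximable if $$\inf_{h\in\mathbb{Z}^d,\,h\ne0}\left(\max_{1\le i\le r}\|\langle h,\alpha_i\rangle\|_{\mathbb{R}/\mathbb{Z}}\cdot\|h\|_\infty^{d/r}\right)>0.$$ $\nu^{*k}$ is the $k$-fold convolution of $\nu$. The torus has the Euclidean metric $\|x-y\|_{\mathbb{R}^d/\mathbb{Z}^d}=\min_{m\in\mathbb{Z}^d}|x-y-m|$ ($|\cdot|$ the Euclidean norm), and for $0<p\le1$, $W_p(\nu_1,\nu_2)=\inf_\vartheta\int\|x-y\|_{\mathbb{R}^d/\mathbb{Z}^d}^p\,\mathrm{d}\vartheta(x,y)$ (no exponent $1/p$), the infimum being over all Borel probability measures $\vartheta$ on $(\mathbb{R}^d/\mathbb{Z}^d)\times(\mathbb{R}^d/\mathbb{Z}^d)$ with marginals $\nu_1,\nu_2$. *)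

(* Defs.v *)
From HB Require Import structures.
From mathcomp Require Import all_boot all_order all_algebra archimedean.
From mathcomp Require Import generic_quotient ring_quotient.
From mathcomp Require Import all_classical all_reals all_analysis.

Set Implicit Arguments.
Unset Strict Implicit.
Unset Printing Implicit Defensive.

Import Order.TTheory GRing.Theory Num.Theory.
Import numFieldNormedType.Exports.

Local Open Scope classical_set_scope.
Local Open Scope ring_scope.
Local Open Scope quotient_scope.

Section diophantine.
Context {R : realType} {d : nat}.

Definition dist_int (t : R) : R := inf [set `|t - n%:~R| | n in [set: int]].

Definition dotzr (h : 'rV[int]_d) (a : 'rV[R]_d) : R :=
  \sum_(j < d) (h ord0 j)%:~R * a ord0 j.

(* The zero seeds of the iterated maxima, here and below, are harmless: all the
   terms are nonnegative. *)
Definition supnormz (h : 'rV[int]_d) : R := \big[Num.max/0]_(j < d) `|h ord0 j|%:~R.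

Definition badly_approximable (r : nat) (alpha : 'I_r -> 'rV[R]_d) : Prop :=
  0 < inf [set (\big[Num.max/0]_(i < r) dist_int (dotzr h (alpha i)))
               * supnormz h `^ (d%:R / r%:R) | h in [set h | h != 0]].

(* The norm of the library on 'rV[R]_d is the sup norm. *)
Definition enorm (u : 'rV[R]_d) : R := Num.sqrt (\sum_(j < d) u ord0 j ^+ 2).

End diophantine.

Section torus.
Context (R : realType) (d : nat).

Definition Zlattice : {pred 'rV[R]_d} :=
  [pred m : 'rV[R]_d | [forall j, m ord0 j \is a Num.int]].

Lemma Zlattice_zmod_closed : zmod_closed Zlattice.
Proof.
split=> [|u v /forallP uZ /forallP vZ]; apply/forallP => j.
  by rewrite mxE rpred0.
by rewrite !mxE rpredB.
Qed.

HB.instance Definition _ :=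
  GRing.isZmodClosed.Build 'rV[R]_d Zlattice Zlattice_zmod_closed.

(* R^d/Z^d: quotient additive group, quotient topology, and (below) the
   sigma-algebra generated by the open sets. *)
Definition torus : Type := quotient_topology (Quotient.quot Zlattice).

HB.instance Definition _ := Topological.on torus.
HB.instance Definition _ := Pointed.on torus.
HB.instance Definition _ := Quotient.on torus.
HB.instance Definition _ := GRing.isZmodule.Build torus
  (@Quotient.addqA _ Zlattice) (@Quotient.addqC _ Zlattice)
  (@Quotient.add0q _ Zlattice) (@Quotient.addNq _ Zlattice).

HB.instance Definition _ := @isMeasurable.Build (sigma_display (@open torus))
  torus <<s @open torus >>
  (@sigma_algebra0 _ setT (@open torus)) (@sigma_algebraC _ (@open torus))
  (@sigma_algebra_bigcup _ setT (@open torus)).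

Definition torus_pi (u : 'rV[R]_d) : torus := \pi_torus u.

Lemma torus_piD u v : torus_pi (u + v) = torus_pi u + torus_pi v.
Proof. exact: (@Quotient.pi_add _ Zlattice). Qed.

Lemma torus_piP u v : torus_pi u = torus_pi v <-> u - v \in Zlattice.
Proof.
rewrite (@Quotient.idealrBE _ Zlattice).
by split=> h; [apply/eqP; exact h|exact: (eqP h)].
Qed.

Lemma torus_pi_continuous : continuous torus_pi.
Proof. exact: pi_continuous. Qed.

Lemma torus_pi_open (O : set 'rV[R]_d) : open O -> open (torus_pi @` O).
Proof.
move=> oO; rewrite /open /= /quotient_open.
have -> : \pi_torus @^-1` (torus_pi @` O) =
    \bigcup_(m in [set m | m \in Zlattice]) ((fun u => u - m) @^-1` O).
  apply/seteqP; split=> [u [v Ov /esym/torus_piP uvZ]|u [m mZ Om]].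
    exists (u - v) => //.
    by rewrite /preimage /= opprB addrC subrK.
  exists (u - m) => //; apply/torus_piP.
  by rewrite addrAC subrr add0r rpredN.
apply: bigcup_open => m _.
apply: open_comp => // u _.
by apply: (@cvgB _ 'rV[R]_d _ (nbhs u)); [exact: cvg_id|exact: cvg_cst].
Qed.

Let rbox (c : 'rV[rat]_d) (n : nat) : set 'rV[R]_d :=
  ball (map_mx (@ratr R) c : 'rV[R]_d) n.+1%:R^-1.

Let rbox_dense (u : 'rV[R]_d) (n : nat) : exists c, rbox c n u.
Proof.
have e0 : 0 < n.+1%:R^-1 :> R by rewrite invr_gt0.
have hj j : exists q : rat, `|ratr q - u ord0 j| < n.+1%:R^-1.
  have [q] := @rat_in_itvoo R (u ord0 j) (u ord0 j + n.+1%:R^-1)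
    (ltr_pwDr e0 (lexx _)).
  rewrite in_itv /= => /andP[q1 q2]; exists q.
  by rewrite ger0_norm ?subr_ge0 1?ltW// ltrBlDl.
have [c hc] := choice hj.
exists (\row_j c j); rewrite /rbox; split => // i j.
by rewrite !mxE (ord1 i) /ball /=; exact: hc.
Qed.

(* The product sigma-algebra on torus * torus (the library's instance) contains
   the open sets of the product topology, so it is the Borel sigma-algebra. *)
Lemma open_torus2_measurable (U : set (torus * torus)) :
  open U -> measurable U.
Proof.
move=> oU.
pose good (i : 'rV[rat]_d * 'rV[rat]_d * nat) :=
  (torus_pi @` rbox i.1.1 i.2) `*` (torus_pi @` rbox i.1.2 i.2) `<=` U.
pose F i := if `[< good i >] then
  (torus_pi @` rbox i.1.1 i.2) `*` (torus_pi @` rbox i.1.2 i.2) else set0.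
have mbox c n : measurable (torus_pi @` rbox c n).
  by apply: sub_sigma_algebra; apply: torus_pi_open; exact: ball_open.
suff -> : U = \bigcup_i F i.
  apply: countable_bigcupT_measurable => [|i]; first exact: countableP.
  by rewrite /F; case: ifP => _ //; exact: measurableX.
apply/seteqP; split=> [[x y] Uxy|z [i _]]; last first.
  by rewrite /F; case: asboolP => // h Fz; exact: h.
pose u := repr x; pose v := repr y.
have ux : torus_pi u = x by exact: reprK.
have vy : torus_pi v = y by exact: reprK.
have [[A B] /= [nA nB] AB] : nbhs (x, y) U by exact: open_nbhs_nbhs.
have {}nA : nbhs u (torus_pi @^-1` A) by apply: torus_pi_continuous; rewrite ux.
have {}nB : nbhs v (torus_pi @^-1` B) by apply: torus_pi_continuous; rewrite vy.
have [e e0 eAB] : exists2 e : R, 0 < e &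
    ball u e `<=` torus_pi @^-1` A /\ ball v e `<=` torus_pi @^-1` B.
  have /nbhs_ballP[e1 e10 h1] := nA; have /nbhs_ballP[e2 e20 h2] := nB.
  exists (Num.min e1 e2); first by rewrite lt_min e10.
  split=> w bw.
    by apply: h1; apply: le_ball bw; rewrite ge_min lexx.
  by apply: h2; apply: le_ball bw; rewrite ge_min lexx orbT.
have [n ne] : exists n : nat, n.+1%:R^-1 + n.+1%:R^-1 <= e.
  exists (Num.truncn (2 / e)); set k := (Num.truncn _).+1%:R : R.
  have -> : k^-1 + k^-1 = 2 / k by rewrite mulrDl mul1r.
  by rewrite ler_pdivrMr ?ltr0n// mulrC -ler_pdivrMr// ltW// truncnS_gt.
have [c1 hc1] := rbox_dense u n; have [c2 hc2] := rbox_dense v n.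
have sub w c : rbox c n w -> rbox c n `<=` ball w e.
  move=> bw t bt; apply: le_ball ne _ _.
  by apply: ball_triangle bt; exact: ball_sym.
exists (c1, c2, n) => //; rewrite /F; case: asboolP => [_|[]].
  by split; [exists u|exists v].
move=> [s t] /= [[s' hs <-] [t' ht <-]]; apply: AB; split=> /=.
  by apply: (proj1 eAB); exact: sub hs.
by apply: (proj2 eAB); exact: sub ht.
Qed.

Definition torus_add (z : torus * torus) : torus := z.1 + z.2.

Lemma torus_add_open (U : set torus) : open U -> open (torus_add @^-1` U).
Proof.
move=> oU; rewrite openE => -[x y] /= Uxy.
pose u := repr x; pose v := repr y.
have ux : torus_pi u = x by exact: reprK.
have vy : torus_pi v = y by exact: reprK.
have : nbhs (u + v) (torus_pi @^-1` U).
  apply: torus_pi_continuous; rewrite torus_piD ux vy.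
  exact: open_nbhs_nbhs.
move=> /(@add_continuous 'rV[R]_d (u, v)) [[A B] /= [nA nB] AB].
move: nA nB; rewrite !nbhsE => -[A' [oA' A'u] sA] [B' [oB' B'v] sB].
exists (torus_pi @` A', torus_pi @` B') => /=.
  by split; apply: open_nbhs_nbhs; split;
    [exact: torus_pi_open|exists u|exact: torus_pi_open|exists v].
move=> [_ _] /= [[s hs <-] [t ht <-]].
rewrite /torus_add /= -torus_piD.
by apply: (AB (s, t)); split; [exact: sA|exact: sB].
Qed.

Lemma measurable_torus_add : measurable_fun [set: torus * torus] torus_add.
Proof.
apply: (@measurability _ _ _ _ _ _ (@open torus)) => //.
move=> _ [U oU <-]; rewrite setTI.
by apply: open_torus2_measurable; exact: torus_add_open.
Qed.

HB.instance Definition _ :=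
  isMeasurableFun.Build _ _ _ _ torus_add measurable_torus_add.

Definition convolution (nu1 nu2 : probability torus R) : probability torus R :=
  distribution (nu1 \x nu2)%E torus_add.

Definition convolution_pow (nu : probability torus R) (k : nat) :
    probability torus R :=
  iter k (convolution nu) (dirac (0 : torus)).

(* repr picks one lift of each point; the set of values does not depend on the
   lifts, and the infimum is attained. *)
Definition torus_dist (x y : torus) : R :=
  inf [set enorm (repr x - repr y - m) | m in [set m | m \in Zlattice]].

Definition coupling (nu1 nu2 : probability torus R) :
    set (probability (torus * torus)%type R) :=
  [set theta | forall A : set torus, measurable A ->
    theta (fst @^-1` A) = nu1 A /\ theta (snd @^-1` A) = nu2 A].

(* No exponent 1/p. *)
Definition wasserstein (p : R) (nu1 nu2 : probability torus R) : \bar R :=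
  ereal_inf [set (\int[theta]_z (torus_dist z.1 z.2 `^ p)%:E)%E
            | theta in coupling nu1 nu2].

(* Translation-invariant Borel probability measure; unique by uniqueness of the
   Haar measure. *)
Definition normalized_haar (mu : probability torus R) : Prop :=
  forall (x : torus) (A : set torus), measurable A ->
    mu ((fun y => x + y) @^-1` A) = mu A.

End torus.

(* Measurability with respect to the discrete sigma-algebra of a countable T. *)
Definition discrete_rv {disp} {Omega : measurableType disp} {T : countType}
    (X : Omega -> T) : Prop :=
  forall x : T, measurable (X @^-1` [set x]).

Section random_walk.
Context {R : realType} {d r : nat} {disp : measure_display}
  {Omega : measurableType disp}.
Variables (P : probability Omega R) (alpha : 'I_r -> 'rV[R]_d)
  (xi : 'I_r -> Omega -> int) (I : Omega -> 'I_r).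

(* Subfamilies are covered by taking some of the sets equal to setT. *)
Definition mutually_independent : Prop :=
  forall (A : 'I_r -> set int) (C : set 'I_r),
    P (\bigcap_i (xi i @^-1` A i) `&` I @^-1` C) =
    ((\prod_(i < r) P (xi i @^-1` A i)) * P (I @^-1` C))%E.

Definition random_step (w : Omega) : torus R d :=
  torus_pi (alpha (I w) *~ xi (I w) w).

Hypotheses (mxi : forall i, discrete_rv (xi i)) (mI : discrete_rv I).

Lemma measurable_random_step : measurable_fun setT random_step.
Proof.
move=> _ U mU; rewrite setTI.
pose F (z : 'I_r * int) := if `[< U (torus_pi (alpha z.1 *~ z.2)) >]
  then I @^-1` [set z.1] `&` xi z.1 @^-1` [set z.2] else set0.
have -> : random_step @^-1` U = \bigcup_z F z.
  apply/seteqP; split=> [w Uw|w [[i n] _]]; last first.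
    by rewrite /F; case: asboolP => //= Uz [Ii xin]; rewrite /random_step Ii xin.
  by exists (I w, xi (I w) w) => //; rewrite /F; case: asboolP.
apply: countable_bigcupT_measurable => [|z]; first exact: countableP.
by rewrite /F; case: ifP => // _; apply: measurableI; [exact: mI|exact: mxi].
Qed.

Definition random_step_mfun : {mfun Omega >-> torus R d} :=
  mfun_Sub (mem_set measurable_random_step).

Definition step_distribution : probability (torus R d) R :=
  distribution P random_step_mfun.

End random_walk.

(* Main.v *)
Require Import Defs.
From mathcomp Require Import all_boot all_order all_algebra.
From mathcomp Require Import all_classical all_reals all_analysis measurable_realfun.
From mathcomp Require Import ring lra zify.

Import Order.TTheory GRing.Theory Num.Theory.
Import numFieldNormedType.Exports.

Local Open Scope classical_set_scope.
Local Open Scope ring_scope.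

(** Only the number of sites that the walk can reach matters. After [k] steps
the walk is at the image of [\sum_i n_i alpha_i], where [n_i] is the sum of the
increments [xi_i] over the steps whose index is [i]. The second moment of one
increment [xi_i 1_(I = i)] is at most [B], by independence, so [n_i] has variance
at most [k B], and outside an event of probability [r k B / T^2] every [n_i] lies
within [T] of its mean ([walk_tail], Chebyshev). Hence all but [r k B / T^2] of
the mass of [nu^{*k}] sits on at most [(4 T)^r] points of the torus. A ball of
radius [s] has Haar measure at most [(4 s)^d] ([haar_tball_le], by packing), so
for every coupling [theta] with the Haar measure ([walk_near_pairs])

  theta (dist < s) <= r k B / T^2 + (4 T)^r (8 s)^d.

The natural scales are [T ~ k^(1/2)] and [s ~ delta := k^(-r/(2d))]. A single
such pair of scales gives [W_p >= const * delta^p], which is too weak: the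
[p]-th root of the constant tends to 0 with [p]. Uniformity in [p] needs
a bound on the left tail of [dist / delta] at all scales. Taking
[s = a delta e^(-l)] for [l = 0, 1, 2, ...] and letting [T] grow geometrically
but slowly in [l], the bounds above are summable, with sum at most [1/2] when
[a] is small ([scale_choice]). Since [x^p >= 1 - p #{l | x < e^(-l)}] as soon as
finitely many, but at least [1/p], values of [l] are counted, integrating gives

  \int dist^p dtheta >= (a delta)^p (1 - p/2) >= (a delta / e)^p

([integral_powR_ge]), and [c = a / e] works for every [p]. *)

(** * Balls in the torus *)

Section torus_geometry.
Variables (R : realType) (d : nat).
Local Notation pi := (@torus_pi R d).
Implicit Types (u v : 'rV[R]_d) (s : R).

(** The image of a ball of the sup norm: its packing number is that of a cube, and
it contains the image of the Euclidean ball of the same radius. *)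
Definition tball u s : set (torus R d) := pi @` ball u s.

Lemma rV_ballP u v s : 0 < s ->
  ball u s v <-> forall j, `|u ord0 j - v ord0 j| < s.
Proof.
move=> s0; split => [[_ b] j|h]; first exact: b.
by split => // i j; rewrite (ord1 i); exact: h.
Qed.

Lemma measurable_tball u s : measurable (tball u s).
Proof.
by apply: sub_sigma_algebra; apply: torus_pi_open; exact: ball_open.
Qed.

Lemma tball_shift u v s : (fun y => pi v + y) @^-1` tball (v + u) s = tball u s.
Proof.
have shift (a b c : 'rV[R]_d) : ball (c + a) s (c + b) <-> ball a s b.
  by split=> -[s0 h]; split=> // i j; have := h i j;
    rewrite /ball/= !mxE opprD addrACA subrr add0r.
apply/seteqP; split=> y /=.
  case=> w bw ywE; exists (w - v).
    by apply/(shift _ _ v); rewrite [v + (_ - _)]addrC subrK.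
  apply/(addrI (pi v)); rewrite -ywE -torus_piD; congr (pi _).
  by rewrite addrC subrK.
by case=> w bw <-; exists (v + w); [exact/shift|rewrite torus_piD].
Qed.

(** The triangle inequality for the Euclidean torus distance against the sup
norm; the point of the new ball is reached by translating a lift of [x] by
the nearly optimal difference of lifts of [y] and [x]. *)
Lemma tball_torus_dist u (x y : torus R d) s t : 0 < s ->
  tball u s x -> torus_dist x y < t -> tball u (s + t) y.
Proof.
move=> s0 [w buw wx] /inf_lt [|_ [m mZ <-] dt].
  by exists (enorm (repr x - repr y - 0)); exists 0 => //=; exact: rpred0.
have t0 : 0 < t by apply: le_lt_trans dt; rewrite /enorm sqrtr_ge0.
pose z := repr y + m - repr x + w.
have piZ a b : a \in @Zlattice R d -> pi (a + b) = pi b.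
  by move=> aZ; apply/torus_piP; rewrite addrK.
exists z.
  apply: (@ball_triangle _ _ w) => //; apply/rV_ballP => // j.
  apply: le_lt_trans dt.
  have -> : w ord0 j - z ord0 j = (repr x - repr y - m) ord0 j.
    by rewrite /z !mxE; ring.
  rewrite -sqrtr_sqr; apply: ler_wsqrtr.
  rewrite (bigD1 j)//= lerDl; apply: sumr_ge0 => i _; exact: sqr_ge0.
have wxZ : w - repr x \in @Zlattice R d.
  by apply/torus_piP; rewrite wx; apply/esym; exact: reprK.
have -> : z = (m + (w - repr x)) + repr y.
  by apply/rowP => j; rewrite !mxE; ring.
by rewrite (piZ _ _ (rpredD mZ wxZ)); exact: reprK.
Qed.

Section haar.
Variable mu : probability (torus R d) R.
Hypothesis hmu : normalized_haar mu.

Lemma haar_tball_shift u v s : mu (tball u s) = mu (tball v s).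
Proof.
have := hmu (pi (u - v)) (tball (u - v + v) s) (measurable_tball _ _).
by rewrite tball_shift subrK.
Qed.

(** The points of the grid [(1/M) Z^d / Z^d] are separated by [1/M] in the sup
distance of the torus, so balls of radius [1/(2M)] around them are disjoint. *)
Lemma grid_tball_inj (M : nat) s (f g : {ffun 'I_d -> 'I_M}) :
  2 * s * M%:R <= 1 ->
  tball (\row_j ((f j)%:R / M%:R)) s `&` tball (\row_j ((g j)%:R / M%:R)) s !=set0 ->
  f = g.
Proof.
move=> sM [y [[a ba <-] [b bb] /esym /torus_piP /forallP abZ]].
apply/ffunP => j; apply: val_inj => /=.
have M0 : 0 < M%:R :> R by rewrite ltr0n; case: (M) (f j) => // -[].
have /intrP[n nE] := abZ j.
have [_ /(_ ord0 j)] := ba; have [_ /(_ ord0 j)] := bb.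
rewrite /ball /= !mxE => hb ha.
move: nE; rewrite !mxE => nE.
(* Up to the factor 1/M this is the difference of the two points of the balls,
   each less than s away from its centre. *)
have small : `|n * M%:Z - (f j)%:Z + (g j)%:Z| < 1.
  rewrite -(ltr_int R) intr_norm !(intrD, intrM, rmorphN, rmorph1)/= -nE.
  have -> : (a ord0 j - b ord0 j) * M%:~R - (f j)%:~R + (g j)%:~R =
     ((g j)%:R / M%:R - b ord0 j - ((f j)%:R / M%:R - a ord0 j)) * M%:R.
    by rewrite -!pmulrn; field; rewrite gt_eqF.
  rewrite normrM (gtr0_norm M0); apply: lt_le_trans sM.
  rewrite ltr_pM2r//; apply: le_lt_trans (ler_normB _ _) _.
  by rewrite [ltRHS]mulr_natl mulr2n ltrD.
have fM := ltn_ord (f j); have gM := ltn_ord (g j).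
have E : n * M%:Z = (f j)%:Z - (g j)%:Z by lia.
have [n0|n0|n0] := ltrgtP n 0; last by move: E; rewrite n0 mul0r; lia.
  have : n * M%:Z <= -1 * M%:Z by apply: ler_wpM2r; lia.
  lia.
have : 1 * M%:Z <= n * M%:Z by apply: ler_wpM2r; lia.
lia.
Qed.

(** By invariance, the [M^d] disjoint balls around the grid points all have the
same measure, which is therefore at most [M^(-d)]; [M] is the integer part of
[1/(2s)], so that [1/M <= 4 s] when [s <= 1/4], and otherwise the bound is
at least 1. *)
Lemma haar_tball_le u s : 0 < s -> (mu (tball u s) <= ((4 * s) ^+ d)%:E)%E.
Proof.
move=> s0.
have [s4|s4] := lerP s 4^-1; last first.
  apply: le_trans (probability_le1 _ (measurable_tball _ _)) _.
  by rewrite lee_fin exprn_ege1//; lra.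
pose M := Num.truncn (2 * s)^-1.
have s20 : 0 < 2 * s by rewrite mulr_gt0.
have sM : 2 * s * M%:R <= 1.
  by rewrite -ler_pdivlMl// mulr1 truncn_le// invr_ge0 ltW.
have M1 : 1 <= M%:R :> R.
  rewrite ler1n truncn_ge_nat ?invr_ge0 ?(ltW s20)// -[1%:R]invr1 lef_pV2 ?posrE//.
  lra.
have M4 : M%:R^-1 <= 4 * s.
  have MS : 1 < 2 * s * (M%:R + 1).
    by rewrite -ltr_pdivrMl// mulr1 -natr1 addrC natr1 truncnS_gt.
  rewrite -[leLHS]mul1r ler_pdivrMr ?(lt_le_trans ltr01)//.
  have : 2 * s * 1 <= 2 * s * M%:R by rewrite ler_pM2l.
  move: MS; rewrite mulrDr; lra.
pose T : finType := {ffun 'I_d -> 'I_M}.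
pose F (i : 'I_#|T|) := tball (\row_j (((enum_val i : T) j)%:R / M%:R)) s.
have trivF : trivIset setT F.
  move=> i1 i2 _ _ /grid_tball_inj-/(_ sM) /enum_val_inj; exact.
have mF i : measurable (F i) by exact: measurable_tball.
have := @measure_bigsetU_ord _ _ _ mu _ xpredT F mF trivF.
have -> : (\sum_(i < #|T|) mu (F i) = \sum_(i < #|T|) (fine (mu (tball u s)))%:E)%E.
  apply: eq_bigr => i _; rewrite fineK ?fin_num_measure//; last exact: measurable_tball.
  exact: haar_tball_shift.
have cardT : #|T| = (M ^ d)%N by rewrite card_ffun !card_ord.
rewrite sumEFin sumr_const card_ord [in X in (_ *+ X)%:E]cardT => muE.
have : (mu (\big[setU/set0]_(i < #|T|) F i) <= 1)%E.
  by apply: probability_le1; exact: bigsetU_measurable.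
rewrite muE lee_fin => le1.
rewrite -[leLHS]fineK ?fin_num_measure//; last exact: measurable_tball.
rewrite lee_fin; apply: (@le_trans _ _ (M%:R^-1 ^+ d)).
  by rewrite exprVn -[leRHS]mul1r ler_pdivlMr ?exprn_gt0 ?(lt_le_trans ltr01)// -natrX mulr_natr.
by rewrite lerXn2r ?nnegrE ?invr_ge0 ?ler0n ?mulr_ge0// ltW.
Qed.

End haar.
End torus_geometry.

(** * Pairs of close points under a coupling *)

Section near_pairs.
Context {R : realType} {d : nat}.
Implicit Types nu mu : probability (torus R d) R.

Lemma measure_bigcup_fin_le {disp} {X : measurableType disp}
    (m : {measure set X -> \bar R}) (K : finType) (F : K -> set X) (b : R) :
  (forall k, measurable (F k)) -> (forall k, (m (F k) <= b%:E)%E) ->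
  (m (\bigcup_k F k) <= (#|K|%:R * b)%:E)%E.
Proof.
move=> mF Fb.
have -> : \bigcup_k F k = \big[setU/set0]_(k <- enum K) F k.
  rewrite -bigcup_seq; apply: eq_bigcupl; split=> // k _ /=.
  by rewrite mem_enum.
rewrite cardE; elim: (enum K) => [|k s IH].
  by rewrite big_nil measure0 mul0r.
rewrite big_cons /= -natr1 mulrDl mul1r EFinD addeC.
apply: le_trans (measureU2 _ _ _) (leeD (Fb k) IH) => //.
by apply: bigsetU_measurable.
Qed.

(** If [x] and [y] are closer than [s], either [x] is outside the [s]-neighbourhood
of the finite set [u], which the first marginal controls, or [y] is in its
[2s]-neighbourhood, which is small for the Haar measure. The measurable set [G]
stands for the event itself, so that the measurability of the distance
need not be established. *)
Lemma near_pairs (K : finType) (u : K -> 'rV[R]_d) nu mu s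
    (theta : probability (torus R d * torus R d)%type R) :
  normalized_haar mu -> coupling nu mu theta -> 0 < s ->
  exists G : set (torus R d * torus R d),
    [/\ measurable G, (forall z, torus_dist z.1 z.2 < s -> G z) &
      (theta G <= nu (~` \bigcup_k tball R d (u k) s) +
        (#|K|%:R * (8 * s) ^+ d)%:E)%E].
Proof.
move=> hmu cpl s0.
have mU t : measurable (\bigcup_k tball R d (u k) t).
  apply: countable_bigcupT_measurable => [|k]; first exact: countableP.
  exact: measurable_tball.
have mUc : measurable (~` \bigcup_k tball R d (u k) s) by exact: measurableC.
set U1 := ~` _ in mUc *; pose U2 := \bigcup_k tball R d (u k) (s + s).
have m1 : measurable (fst @^-1` U1 : set (torus R d * torus R d)).
  by rewrite -[X in measurable X]setTI; exact: measurable_fst.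
have m2 : measurable (snd @^-1` U2 : set (torus R d * torus R d)).
  by rewrite -[X in measurable X]setTI; exact: (measurable_snd _ _ (mU _)).
exists (fst @^-1` U1 `|` snd @^-1` U2); split.
- exact: measurableU.
- move=> [x y] /= xy; have [Ux|] := pselect (U1 x); first by left.
  by move=> /contrapT[k _ kx]; right; exists k => //; exact: tball_torus_dist kx xy.
apply: le_trans (measureU2 _ m1 m2) _ => //.
have [<- _] := cpl _ mUc; apply: leeD => //.
have [_ tU2] := cpl _ (mU (s + s)); rewrite [leLHS]tU2.
apply: measure_bigcup_fin_le => k; first exact: measurable_tball.
have -> : 8 * s = 4 * (s + s) by ring.
by apply: haar_tball_le => //; rewrite addr_gt0.
Qed.

End near_pairs.

(** * Second moments *)

Section moments.
Context {R : realType} {disp : measure_display} {Omega : measurableType disp}.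
Variable P : probability Omega R.

Lemma discrete_measurable_fun {T : countType} {disp' : measure_display}
    {U : measurableType disp'} (X : Omega -> T) (f : T -> U) :
  discrete_rv X -> measurable_fun setT (f \o X).
Proof.
move=> mX _ A _; rewrite setTI.
have -> : (f \o X) @^-1` A = \bigcup_(t in f @^-1` A) (X @^-1` [set t]).
  by apply/seteqP; split=> [w Aw|w [t At Xwt]]; [exists (X w)|rewrite /= Xwt].
rewrite bigcup_mkcond; apply: countable_bigcupT_measurable => [|t].
  exact: countableP.
by case: ifP.
Qed.

(** Away from 0, the law of [X 1_E] is [P E] times the law of [X], and [x ^+ 2]
does not see the mass at 0. The argument needs no integrability, so it also
covers an infinite second moment multiplied by [P E = 0]. *)
Lemma second_moment_indep (X : Omega -> R) (E : set Omega) :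
  measurable_fun setT X -> measurable E ->
  (forall A : set R, measurable A ->
    P (X @^-1` A `&` E) = (P (X @^-1` A) * P E)%E) ->
  (\int[P]_w ((X w * \1_E w) ^+ 2)%:E <= P E * \int[P]_w ((X w) ^+ 2)%:E)%E.
Proof.
move=> mX mE XE.
pose Y w := X w * \1_E w.
have mY : measurable_fun setT Y by apply: measurable_funM.
pose X' : {mfun Omega >-> R} := mfun_Sub (mem_set mX).
pose Y' : {mfun Omega >-> R} := mfun_Sub (mem_set mY).
pose D := ~` [set 0 : R].
have mD : measurable D by apply: measurableC.
have mf A : measurable_fun A (fun x : R => (x ^+ 2)%:E).
  by apply/measurable_EFinP; exact: measurable_funTS.
have sq0 (x : R) : (0 <= (x ^+ 2)%:E)%E by rewrite lee_fin sqr_ge0.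
have -> : (\int[P]_w ((X w * \1_E w) ^+ 2)%:E = \int[distribution P Y']_(x in D) (x ^+ 2)%:E)%E.
  rewrite ge0_integral_pushforward// [RHS]integral_mkcond; apply: eq_integral => w _.
  rewrite /patch; case: ifPn => //; rewrite notin_setE /D /preimage/= => /contrapT.
  by rewrite /Y => ->; rewrite expr0n.
have PE0 : 0 <= fine (P E) by rewrite fine_ge0.
have -> : (\int[distribution P Y']_(x in D) (x ^+ 2)%:E =
     \int[mscale (NngNum PE0) (distribution P X')]_(x in D) (x ^+ 2)%:E)%E.
  apply: eq_measure_integral => A mA AD.
  rewrite -[LHS]/(P (Y @^-1` A)) -[RHS]/((fine (P E))%:E * P (X @^-1` A))%E.
  rewrite fineK ?fin_num_measure// muleC -XE//.
  congr (P _); apply/seteqP; split=> w /=; rewrite /Y indicE.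
    have [wE|wE] := boolP (w \in E); first by rewrite mulr1; split => //; exact: set_mem.
    by rewrite mulr0 => /AD; rewrite /D /=.
  by case=> AX /mem_set ->; rewrite mulr1.
rewrite ge0_integral_mscale//= fineK ?fin_num_measure//.
apply: lee_wpmul2l => //.
rewrite ge0_integral_pushforward//.
apply: ge0_subset_integral => //; first exact: measurable_funPTI.
  by apply/measurable_EFinP; exact: measurable_funX.
by move=> w _; exact: sq0.
Qed.

Lemma integrable_of_sqr (Y : Omega -> R) (B : R) : measurable_fun setT Y ->
  (\int[P]_w (Y w ^+ 2)%:E <= B%:E)%E ->
  P.-integrable setT (EFin \o (fun w => Y w ^+ 2)) /\ P.-integrable setT (EFin \o Y).
Proof.
move=> mY YB.
have iY2 : P.-integrable setT (EFin \o (fun w => Y w ^+ 2)).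
  apply/integrableP; split; first by apply/measurable_EFinP; exact: measurable_funX.
  apply: le_lt_trans (ltry B); apply: le_trans YB.
  by under eq_integral do rewrite /= ger0_norm ?sqr_ge0//.
split=> //.
have i1 : P.-integrable setT (EFin \o cst (1 : R)) by exact: finite_measure_integrable_cst.
apply: (le_integrable _ _ _ (integrableD _ i1 iY2)) => //; first exact/measurable_EFinP.
move=> w _ /=; rewrite lee_fin [leRHS]ger0_norm ?addr_ge0 ?sqr_ge0//.
rewrite -[Y w ^+ 2]real_normK ?num_real//.
by have := sqr_ge0 (`|Y w| - 1); have := normr_ge0 (Y w); nra.
Qed.

(** [E (c - Y)^2 = (c - E Y)^2 + Var Y] and [Var Y <= E Y^2]. *)
Lemma second_moment_shift (Y : Omega -> R) (B c : R) : measurable_fun setT Y ->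
  (\int[P]_w (Y w ^+ 2)%:E <= B%:E)%E ->
  (\int[P]_w ((c - Y w) ^+ 2)%:E <= ((c - fine (\int[P]_w (Y w)%:E)) ^+ 2 + B)%:E)%E.
Proof.
move=> mY YB; have [iY2 iY] := integrable_of_sqr _ _ mY YB.
set m := fine _.
have mE : (\int[P]_w (Y w)%:E = m%:E)%E by rewrite fineK ?integrable_fin_num.
have -> : (\int[P]_w ((c - Y w) ^+ 2)%:E =
   \int[P]_w (cst (c ^+ 2)%:E w + ((Y w ^+ 2)%:E + (- 2 * c)%:E * (Y w)%:E)))%E.
  by apply: eq_integral => w _; rewrite -EFinM -!EFinD; congr EFin; rewrite /=; ring.
have ic : P.-integrable setT (cst (c ^+ 2)%:E) by exact: finite_measure_integrable_cst.
have iZ : P.-integrable setT (fun w => (- 2 * c)%:E * (Y w)%:E)%E by exact: integrableZl.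
rewrite integralD//; last exact: integrableD.
rewrite integralD// integralZl// mE integral_cst// [X in (_ * X)%E](probability_setT P) mule1.
apply: (@le_trans _ _ ((c ^+ 2)%:E + (B%:E + (- 2 * c)%:E * m%:E))%E).
  by rewrite leeD2l// leeD2r.
by rewrite -EFinM -!EFinD lee_fin; have := sqr_ge0 m; nra.
Qed.

End moments.

(** * Concentration of the walk on few sites *)

Section concentration.
Context {R : realType} {d r : nat} {disp : measure_display}
  {Omega : measurableType disp}.
Variables (P : probability Omega R) (alpha : 'I_r -> 'rV[R]_d)
  (xi : 'I_r -> Omega -> int) (I : Omega -> 'I_r).
Hypotheses (mxi : forall i, discrete_rv (xi i)) (mI : discrete_rv I).
Hypothesis indep : mutually_independent P xi I.
Variable B : R.
Hypothesis moment : forall i,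
  (P (I @^-1` [set i]) * 'E_P[fun w => ((xi i w)%:~R ^+ 2 : R)%R] <= B%:E)%E.
Local Notation nu := (step_distribution P alpha mxi mI).

(** The random vector [(increment i w)_i] lifts the step of the walk from the
torus to [Z^r]; unlike the points of the torus, vectors in [Z^r] have second
moments. *)
Definition increment (i : 'I_r) (w : Omega) : int := if I w == i then xi i w else 0.

Definition walk_site (n : 'I_r -> int) : torus R d :=
  @torus_pi R d (\sum_i alpha i *~ n i).

Lemma walk_siteD (n1 n2 : 'I_r -> int) :
  walk_site n1 + walk_site n2 = walk_site (fun i => n1 i + n2 i).
Proof.
rewrite /walk_site -torus_piD -big_split; congr (torus_pi _).
by apply: eq_bigr => i _; rewrite mulrzDr.
Qed.

Lemma random_stepE w : random_step alpha xi I w = walk_site (increment ^~ w).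
Proof.
rewrite /walk_site (bigD1 (I w))//= big1 => [|i iI]; first by rewrite addr0 /increment eqxx.
by rewrite /increment eq_sym (negbTE iI) mulr0z.
Qed.

Let measurable_increment i : measurable_fun setT (fun w => (increment i w)%:~R : R).
Proof.
have -> : (fun w => (increment i w)%:~R) =
    (fun w => (xi i w)%:~R * \1_(I @^-1` [set i]) w) :> (Omega -> R).
  apply/funext => w; rewrite /increment indicE; case: eqP => Iwi.
    by rewrite mem_set ?mulr1.
  by rewrite memNset ?mulr0.
apply: measurable_funM; last exact: measurable_indic.
exact: (discrete_measurable_fun (xi i) (fun n : int => n%:~R : R)).
Qed.

Lemma increment_second_moment i :
  (\int[P]_w ((increment i w)%:~R ^+ 2 : R)%:E <= B%:E)%E.
Proof.
have := moment i; rewrite unlock; apply: le_trans.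
have -> : (\int[P]_w ((increment i w)%:~R ^+ 2 : R)%:E =
   \int[P]_w (((xi i w)%:~R * \1_(I @^-1` [set i]) w) ^+ 2 : R)%:E)%E.
  apply: eq_integral => w _; rewrite /increment indicE; case: eqP => Iwi.
    by rewrite mem_set ?mulr1.
  by rewrite memNset ?mulr0.
apply: second_moment_indep; [|exact: mI|].
  exact: (discrete_measurable_fun (xi i) (fun n : int => n%:~R : R)).
move=> A mA.
have := indep (fun j => if j == i then [set n : int | A (n%:~R)] else setT) [set i].
have -> : \bigcap_j (xi j @^-1` (if j == i then [set n : int | A (n%:~R)] else setT)) =
    (fun w => (xi i w)%:~R) @^-1` A.
  apply/seteqP; split=> w /= h; first by have := h i Logic.I; rewrite eqxx.
  by move=> j _; case: eqP => // ->.
move=> ->; congr (_ * _)%E.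
rewrite (bigD1 i)//= eqxx big1 ?mule1// => j /negbTE ->.
by rewrite preimage_setT probability_setT.
Qed.

Let drift (i : 'I_r) : R := fine (\int[P]_w (((increment i w)%:~R : R)%:E)).

Let measurable_add_preimage (D : set (torus R d)) : measurable D ->
  measurable (@torus_add R d @^-1` D).
Proof.
by move=> mD; rewrite -[X in measurable X]setTI; exact: measurable_torus_add.
Qed.

Lemma xsection_torus_add (x : torus R d) (D : set (torus R d)) :
  xsection (@torus_add R d @^-1` D) x = (fun y => x + y) @^-1` D.
Proof.
by apply/seteqP; split=> y /=; [move/set_mem|move=> ?; apply/mem_set].
Qed.

Lemma convolution_step (rho : probability (torus R d) R) (D : set (torus R d)) :
  measurable D ->
  convolution nu rho D =
  (\int[P]_w rho ((fun y => (random_step alpha xi I w + y)%R) @^-1` D))%E.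
Proof.
move=> /measurable_add_preimage mA.
rewrite -[LHS]/((nu \x rho)%E (@torus_add R d @^-1` D)) /product_measure1.
rewrite ge0_integral_distribution//; last exact: measurable_fun_xsection.
by apply: eq_integral => w _; rewrite -xsection_torus_add.
Qed.

Lemma measurable_random_translate (rho : probability (torus R d) R)
    (D : set (torus R d)) : measurable D ->
  measurable_fun setT
    (fun w => rho ((fun y => random_step alpha xi I w + y) @^-1` D)).
Proof.
move=> /measurable_add_preimage mA.
have := measurableT_comp (measurable_fun_xsection rho mA)
  (measurable_random_step alpha mxi mI).
by apply: eq_measurable_fun => w _; rewrite -xsection_torus_add.
Qed.

(** Chebyshev inequality for the lifted walk, stated on the torus: a set [D] that
avoids all sites with coordinates within [T] of [c] has small mass. Keeping the
centre [c] arbitrary makes the induction on [k] go through one integral over the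
first step: that step replaces [c i] by [c i - increment i], and
[second_moment_shift] absorbs it. Thus neither the law of the walk on [Z^r] nor
its covariances have to be introduced. *)
Lemma walk_tail (k : nat) (c : 'I_r -> R) (T : R) (D : set (torus R d)) :
  0 <= T -> measurable D ->
  (forall n, D (walk_site n) -> exists i, T < `|(n i)%:~R - c i|) ->
  ((T ^+ 2)%:E * convolution_pow nu k D <=
    (\sum_i ((c i - k%:R * drift i) ^+ 2 + k%:R * B))%:E)%E.
Proof.
have B0 (i : 'I_r) : 0 <= B.
  by rewrite -lee_fin; apply: le_trans (increment_second_moment i);
    apply: integral_ge0 => w _; rewrite lee_fin sqr_ge0.
elim: k c D => [|k IH] c D T0 mD far.
  rewrite /convolution_pow /= diracE.
  have [D0|D0] := boolP (0 \in D); last first.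
    rewrite mule0 lee_fin; apply: sumr_ge0 => i _.
    by rewrite !mul0r addr0 sqr_ge0.
  have [|i ci] := far (fun=> 0).
    rewrite /walk_site big1 => [|i _]; last exact: mulr0z.
    suff -> : @torus_pi R d 0 = 0 by exact: set_mem.
    by apply: (addrI (@torus_pi R d 0)); rewrite -torus_piD !addr0.
  rewrite mule1 lee_fin (bigD1 i)//= -[leLHS]addr0 lerD//; last first.
    by apply: sumr_ge0 => j _; rewrite !mul0r addr0 sqr_ge0.
  rewrite !mul0r addr0 subr0; move: ci; rewrite mulr0z sub0r normrN => ci.
  by rewrite -[c i ^+ 2]real_normK ?num_real// lerXn2r ?nnegrE// ltW.
rewrite [convolution_pow _ _ _]convolution_step//.
have mconv := measurable_random_translate (convolution_pow nu k) D mD.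
rewrite -ge0_integralZl//; last by rewrite lee_fin sqr_ge0.
apply: (@le_trans _ _ (\int[P]_w
   \sum_i ((c i - k%:R * drift i - (increment i w)%:~R) ^+ 2 + k%:R * B)%:E)%E).
  apply: ge0_le_integral => //.
  - by move=> w _; rewrite mule_ge0// lee_fin sqr_ge0.
  - exact: measurable_funeM.
  - apply: emeasurable_sum => i; apply/measurable_EFinP.
    by apply: measurable_funD => //; apply: measurable_funX; exact: measurable_funB.
  move=> w _.
  under eq_bigr do rewrite addrAC.
  rewrite sumEFin; apply: IH => //.
    by rewrite -xsection_torus_add; apply: measurable_xsection; exact: measurable_add_preimage.
  move=> n /=; rewrite random_stepE walk_siteD => /far[i].
  rewrite intrD => ni; exists i.
  by rewrite [X in `|X|](_ : _ = (increment i w)%:~R + (n i)%:~R - c i)//; ring.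
rewrite ge0_integral_sum//; last 2 first.
- move=> i; apply/measurable_EFinP.
  by apply: measurable_funD => //; apply: measurable_funX; exact: measurable_funB.
- by move=> i w _; rewrite lee_fin addr_ge0 ?sqr_ge0// mulr_ge0// (B0 i).
rewrite -sumEFin; apply: lee_sum => i _.
under eq_integral do rewrite EFinD.
rewrite ge0_integralD//; last 3 first.
- by move=> w _; rewrite lee_fin sqr_ge0.
- by apply/measurable_EFinP; apply: measurable_funX; exact: measurable_funB.
- by move=> w _; rewrite lee_fin mulr_ge0// (B0 i).
rewrite integral_cst// [X in (_ * X)%E](probability_setT P) mule1.
apply: (@le_trans _ _ (((c i - k%:R * drift i - drift i) ^+ 2 + B)%:E + (k%:R * B)%:E)%E).
  by rewrite leeD2r//; apply: second_moment_shift => //; exact: increment_second_moment.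
rewrite -EFinD lee_fin -natr1 le_eqVlt; apply/orP; left; apply/eqP; ring.
Qed.

(** With [c] the mean position, the sites within [T] of [c] lie in a box of [M ^ r]
lattice points, where [M <= 4 T]; they play the role of the finite set in
[near_pairs]. *)
Lemma walk_near_pairs (k : nat) (T s : R) (mu : probability (torus R d) R)
    (theta : probability (torus R d * torus R d)%type R) :
  normalized_haar mu -> coupling (convolution_pow nu k) mu theta ->
  1 <= T -> 0 < s ->
  exists G : set (torus R d * torus R d),
    [/\ measurable G, (forall z, torus_dist z.1 z.2 < s -> G z) &
      (theta G <= (r%:R * (k%:R * B) / T ^+ 2 + (4 * T) ^+ r * (8 * s) ^+ d)%:E)%E].
Proof.
move=> hmu cpl T1 s0.
have T0 : 0 < T by apply: lt_le_trans T1.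
pose c i := k%:R * drift i.
(* The integers of an interval of length 2T are among the truncn(2T)+2 ones that
   start with the integer part of its left end. *)
pose M := (Num.truncn (2 * T)).+2.
have ME : M%:R = (Num.truncn (2 * T))%:R + 2 :> R by rewrite /M -addn2 natrD.
pose base i := Num.floor (c i - T).
pose site (f : {ffun 'I_r -> 'I_M}) : 'rV[R]_d := \sum_i alpha i *~ (base i + (f i)%:Z).
have [G [mG nearG Gle]] := near_pairs _ site _ mu s theta hmu cpl s0.
exists G; split=> //; apply: le_trans Gle _.
have mU : measurable (\bigcup_f tball R d (site f) s).
  apply: countable_bigcupT_measurable => [|f]; first exact: countableP.
  exact: measurable_tball.
have mD := measurableC mU.
rewrite EFinD; apply: leeD; last first.
  rewrite lee_fin ler_wpM2r ?exprn_ge0 ?mulr_ge0 ?(ltW s0)//.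
  rewrite card_ffun !card_ord natrX lerXn2r ?nnegrE ?mulr_ge0 ?(ltW T0)//.
  rewrite ME.
  have := @truncn_le R (2 * T); rewrite mulr_ge0 ?(ltW T0)//; lra.
have far n : (~` \bigcup_f tball R d (site f) s) (walk_site n) ->
    exists i, T < `|(n i)%:~R - c i|.
  move=> nU; apply: contrapT => none; apply: nU.
  have close i : `|(n i)%:~R - c i| <= T.
    by rewrite leNgt; apply/negP => h; apply: none; exists i.
  exists [ffun i => inord `|n i - base i|%N] => //.
  exists (\sum_i alpha i *~ n i) => //.
  have -> : site [ffun i => inord `|n i - base i|%N] = \sum_i alpha i *~ n i.
    apply: eq_bigr => i _; congr (_ *~ _); rewrite ffunE.
    move: (close i); rewrite ler_norml => /andP[lo hi].
    have := floor_le (c i - T); have := floorD1_gt (c i - T); rewrite -/(base i) => b1 b2.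
    have n0 : 0 <= n i - base i by rewrite subr_ge0 -(ler_int R); lra.
    have nM : n i - base i < M%:Z.
      rewrite -(ltr_int R) intrB -pmulrn ME.
      have := truncnS_gt (2 * T); rewrite -addn1 natrD; move: b1; rewrite intrD; lra.
    rewrite inordK; first by rewrite gez0_abs//; lia.
    lia.
  exact: ballxx.
have := walk_tail k c T _ (ltW T0) mD far.
have -> : \sum_i ((c i - k%:R * drift i) ^+ 2 + k%:R * B) = r%:R * (k%:R * B).
  rewrite (eq_bigr (fun=> k%:R * B)) => [|i _]; last by rewrite subrr expr0n add0r.
  by rewrite sumr_const card_ord [RHS]mulr_natl.
rewrite -[X in (_ * X)%E]fineK ?fin_num_measure// -EFinM lee_fin => tail.
rewrite -[leLHS]fineK ?fin_num_measure// lee_fin.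
by rewrite ler_pdivlMr ?exprn_gt0// mulrC.
Qed.

End concentration.

(** * Lower bounds for power means that are uniform in the exponent *)

Section power_means.
Context {R : realType}.

(** The integral of a nonnegative function is a supremum over the simple functions
below it, hence monotone without any measurability. *)
Lemma integral_ge_subfun {disp} {X : measurableType disp}
    (m : {measure set X -> \bar R}) (f g : X -> \bar R) :
  (forall x, 0 <= f x)%E -> (forall x, f x <= g x)%E ->
  (\int[m]_x f x <= \int[m]_x g x)%E.
Proof.
move=> f0 fg; have g0 x : (0 <= g x)%E := le_trans (f0 x) (fg x).
rewrite !ge0_integralTE//; apply: ge_ereal_sup => _ [h hf <-].
by apply: ereal_sup_ubound; exists h => // x; exact: le_trans (hf x) (fg x).
Qed.

(** If [j] is least with [t e^(-j) <= x] then the sum counts at least the [l < j],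
and [1 - p j <= e^(-p j) <= (x / t)^p]. If there is no such [j] below [m], all
[m] terms are counted and the left-hand side is at most 0, as [1 <= p m]. *)
Lemma powR_ge_count (x t p : R) (m : nat) (b : nat -> bool) :
  0 <= x -> 0 < t -> 0 < p -> 1 <= p * m%:R ->
  (forall l, x < t * expR (- l%:R) -> b l) ->
  t `^ p * (1 - p * \sum_(l < m) (b l)%:R) <= x `^ p.
Proof.
move=> x0 t0 p0 pm hb.
have t_p : 0 < t `^ p by exact: powR_gt0.
have countP j : (j <= m)%N -> (forall l, (l < j)%N -> x < t * expR (- l%:R)) ->
    j%:R <= \sum_(l < m) (b l)%:R :> R.
  move=> jm lj.
  rewrite -(big_mkord xpredT (fun l => (b l)%:R)) (@big_cat_nat _ _ _ j)//=.
  rewrite -[leLHS]addr0 lerD ?sumr_ge0//.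
  rewrite big_mkord [leRHS](eq_bigr (fun=> 1)) => [|i _].
    by rewrite sumr_const card_ord.
  by rewrite hb// lj.
have [[j jx]|none] := pselect (exists j : nat, t * expR (- j%:R) <= x); last first.
  apply: (@le_trans _ _ 0); last exact: powR_ge0.
  rewrite pmulr_rle0// subr_le0; apply: le_trans pm _.
  rewrite ler_pM2l//; apply: countP => // l _.
  by rewrite ltNge; apply/negP => h; apply: none; exists l.
have ex : exists j : nat, t * expR (- j%:R) <= x by exists j.
case: (ex_minnP ex) => {jx}j jx jmin.
have [jm|mj] := leqP j m; last first.
  apply: (@le_trans _ _ 0); last exact: powR_ge0.
  rewrite pmulr_rle0// subr_le0; apply: le_trans pm _.
  rewrite ler_pM2l//; apply: countP => // l lm.
  rewrite ltNge; apply/negP => h; have := jmin _ h.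
  by rewrite leqNgt (ltn_trans lm mj).
apply: (@le_trans _ _ ((t * expR (- j%:R)) `^ p)); last first.
  by apply: ge0_ler_powR; rewrite ?nnegrE ?mulr_ge0 ?expR_ge0 ?(ltW t0) ?(ltW p0).
rewrite powRM ?expR_ge0 ?(ltW t0)// ler_pM2l// -expRM.
apply: le_trans (expR_ge1Dx _); rewrite lerD2l mulNr lerN2 mulrC ler_pM2l//.
apply: countP => // l lj; rewrite ltNge; apply/negP => h; have := jmin _ h.
by rewrite leqNgt lj.
Qed.

(** Integrating [powR_ge_count] loses only a factor [1 - p/2 >= e^(-p)], that is, a
constant factor after taking the [p]-th root. *)
Lemma integral_powR_ge {disp} {X : measurableType disp} (theta : probability X R)
    (f : X -> R) (t p : R) (G : nat -> set X) (b : nat -> R) :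
  (forall x, 0 <= f x) -> 0 < t -> 0 < p <= 1 ->
  (forall l, measurable (G l)) ->
  (forall l x, f x < t * expR (- l%:R) -> G l x) ->
  (forall l, (theta (G l) <= (b l)%:E)%E) ->
  (forall m, \sum_(l < m) b l <= 2^-1) ->
  (((t * expR (- 1)) `^ p)%:E <= \int[theta]_x (f x `^ p)%:E)%E.
Proof.
move=> f0 t0 /andP[p0 p1] mG fG Gb bsum.
have t_p : 0 < t `^ p by exact: powR_gt0.
pose m := (Num.truncn p^-1).+1.
have pm : 1 <= p * m%:R.
  by rewrite -ler_pdivrMl// mulr1 ltW// truncnS_gt.
pose S x : R := \sum_(l < m) \1_(G l) x.
have mS : measurable_fun setT S.
  by apply: measurable_sum => l; exact: measurable_indic.
have S0 x : 0 <= S x by apply: sumr_ge0.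
pose h x := Num.max 0 (1 - p * S x).
have mh : measurable_fun setT h.
  apply: measurable_maxr => //; apply: measurable_funB => //.
  exact: measurable_funM.
have h0 x : 0 <= h x by rewrite le_max lexx.
have hf x : t `^ p * h x <= f x `^ p.
  rewrite /h; case: (leP 0 (1 - p * S x)) => _; last first.
    by rewrite mulr0 powR_ge0.
  rewrite /S; under eq_bigr do rewrite indicE.
  apply: (@powR_ge_count (f x) t p m (fun l => x \in G l)) => // l fx.
  by apply/mem_set/fG.
apply: (@le_trans _ _ (\int[theta]_x (t `^ p * h x)%:E)%E); last first.
  by apply: integral_ge_subfun => x; rewrite lee_fin// mulr_ge0// ltW.
under eq_integral do rewrite EFinM.
rewrite ge0_integralZl//; last 3 first.
- exact/measurable_EFinP.
- by move=> x _; rewrite lee_fin.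
- by rewrite lee_fin ltW.
rewrite powRM ?expR_ge0 ?(ltW t0)// EFinM lee_pmul2l// -expRM mulN1r.
(* From e^p >= 1 + p and (1 + p)(1 - p/2) >= 1, which is where p <= 1 enters. *)
have expp : expR (- p) <= 1 - p / 2.
  rewrite -[leLHS]mulr1 expRN ler_pdivrMl ?expR_gt0//.
  apply: (@le_trans _ _ ((1 + p) * (1 - p / 2))); first by nra.
  by rewrite ler_wpM2r ?expR_ge1Dx//; lra.
have ihS : (1 <= \int[theta]_x (h x)%:E + (p / 2)%:E)%E.
  apply: (@le_trans _ _ (\int[theta]_x ((h x)%:E + (p * S x)%:E))%E).
    rewrite -[X in (X <= _)%E](probability_setT theta) -[X in (X <= _)%E]mul1e.
    rewrite -integral_cst//; apply: ge0_le_integral => //.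
    - by apply: emeasurable_funD; apply/measurable_EFinP => //; exact: measurable_funM.
    - move=> x _ /=; rewrite -EFinD lee_fin -lerBlDr.
      by rewrite /h le_max lexx orbT.
  rewrite ge0_integralD//; last 4 first.
  - by move=> x _; rewrite lee_fin.
  - exact/measurable_EFinP.
  - by move=> x _; rewrite lee_fin mulr_ge0// ltW.
  - by apply/measurable_EFinP; exact: measurable_funM.
  rewrite leeD2l//; under eq_integral do rewrite EFinM.
  rewrite ge0_integralZl//; last 3 first.
  - exact/measurable_EFinP.
  - by move=> x _; rewrite lee_fin.
  - by rewrite lee_fin ltW.
  rewrite EFinM lee_pmul2l//.
  under eq_integral do rewrite /S -sumEFin.
  rewrite ge0_integral_sum//; last first.
    by move=> l; apply/measurable_EFinP.
  under eq_bigr do rewrite integral_indic// setIT.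
  apply: (@le_trans _ _ (\sum_(l < m) (b l)%:E)%E); last first.
    by rewrite sumEFin lee_fin.
  by apply: lee_sum => l _; exact: Gb.
have {}ihS : ((1 - p / 2)%:E <= \int[theta]_x (h x)%:E)%E by rewrite EFinB leeBlDr//.
by apply: le_trans ihS; rewrite lee_fin.
Qed.

End power_means.

(** * Choice of the scales *)

Lemma geometric_sum_le (R : realType) (q : R) (m : nat) : 0 < q < 1 ->
  \sum_(l < m) q ^+ l <= (1 - q)^-1.
Proof.
move=> /andP[q0 q1].
rewrite -[leRHS]mul1r ler_pdivlMr ?subr_gt0//.
have -> : (\sum_(l < m) q ^+ l) * (1 - q) = 1 - q ^+ m.
  rewrite -[1 in RHS](expr1n _ m) subrXX mulrC; congr (_ * _).
  by apply: eq_bigr => i _; rewrite expr1n mul1r.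
by rewrite gerBl exprn_ge0// ltW.
Qed.

(** With [q = e^(-1/(2r))] and [T_l] proportional to [q^(-l)], the first term decays
like [q^(2l)], while the growth [q^(-rl) = e^(l/2)] of [T_l^r] costs only half of
the decay of [e^(-d l)]. So both terms are at most multiples of [q^l]: the
first is made small by [L], the second afterwards by [a]. *)
Lemma scale_choice (R : realType) (d r : nat) (B : R) :
  (0 < d)%N -> (0 < r)%N -> 0 < B ->
  exists2 a : R, 0 < a & forall sigma delta : R,
    1 <= sigma -> 0 < delta -> sigma ^+ r * delta ^+ d = 1 ->
  exists2 T : nat -> R, (forall l, 1 <= T l) &
    forall m, \sum_(l < m) (r%:R * (sigma ^+ 2 * B) / T l ^+ 2 +
      (4 * T l) ^+ r * (8 * (a * delta * expR (- l%:R))) ^+ d) <= 2^-1.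
Proof.
move=> d0 r0 B0.
have r2 : 0 < (2 * r)%:R^-1 :> R by rewrite invr_gt0 ltr0n muln_gt0.
pose q : R := expR (- (2 * r)%:R^-1).
have q0 : 0 < q by exact: expR_gt0.
have q1 : q < 1 by rewrite /q expR_lt1 oppr_lt0.
have qE l : expR (- l%:R) = q ^+ (2 * r * l) :> R.
  rewrite /q -expRM_natl; congr expR.
  by rewrite natrM mulrN mulrAC divff ?mul1r// pnatr_eq0 muln_eq0/= -lt0n.
pose L := 1 + 4 * (r%:R * B) / (1 - q).
have L1 : 1 <= L by rewrite lerDl divr_ge0 ?mulr_ge0 ?subr_ge0 ?(ltW B0) ?(ltW q1).
have L0 : 0 < L by apply: lt_le_trans L1.
(* The constant of the second term once sigma ^+ r * delta ^+ d = 1 is used;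
   a is of size 1/C because a ^+ d <= a. *)
pose C := 4 ^+ r * 8 ^+ d * L ^+ r.
have C1 : 1 <= C by rewrite !mulr_ege1 ?exprn_ege1//; lra.
have C0 : 0 < C by apply: lt_le_trans C1.
pose a := (1 - q) / (4 * C).
have a0 : 0 < a by rewrite divr_gt0 ?subr_gt0// mulr_gt0.
have C40 : 0 < 4 * C by rewrite mulr_gt0.
have a1 : a <= 1.
  rewrite /a ler_pdivrMr// mul1r.
  by move: C1 q0; clear; move: (C) (q) => c x; lra.
exists a => // sigma delta s1 dl0 sd.
have s0 : 0 < sigma by apply: lt_le_trans s1.
pose T l := L * q ^- l * sigma.
have qV l : 1 <= q ^- l by rewrite invf_ge1 ?exprn_gt0// exprn_ile1// ltW.
exists T => [l|m]; first by rewrite !mulr_ege1.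
pose A := r%:R * B / L ^+ 2.
have A0 : 0 < A by rewrite divr_gt0 ?exprn_gt0// mulr_gt0// ltr0n.
have A4 : A <= (1 - q) / 4.
  rewrite /A ler_pdivrMr ?exprn_gt0//.
  have : 4 * (r%:R * B) / (1 - q) <= L ^+ 2.
    apply: (@le_trans _ _ L); first by rewrite lerDr.
    by rewrite expr2 -[leLHS]mulr1 ler_pM2l.
  rewrite ler_pdivrMr ?subr_gt0//; lra.
apply: (@le_trans _ _ (\sum_(l < m) (A + C * a) * q ^+ l)); last first.
  rewrite -mulr_sumr.
  apply: (@le_trans _ _ ((1 - q) / 2 * (1 - q)^-1)); last first.
    by rewrite mulrAC divff ?mul1r// gt_eqF// subr_gt0.
  apply: ler_pM.
  - by rewrite ltW// addr_gt0// mulr_gt0.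
  - by apply: sumr_ge0 => l _; rewrite exprn_ge0 ?ltW.
  - have -> : C * a = (1 - q) / 4 by rewrite /a; field; rewrite gt_eqF.
    by move: A4; lra.
  - by apply: geometric_sum_le; rewrite q0.
apply: ler_sum => l _; rewrite [leRHS]mulrDl; apply: lerD.
  have -> : r%:R * (sigma ^+ 2 * B) / T l ^+ 2 = A * (q ^+ l) ^+ 2.
    by rewrite /T /A; field; rewrite !gt_eqF ?exprn_gt0.
  rewrite ler_wpM2l ?(ltW A0)//.
  by rewrite expr2 ger_pMl ?exprn_gt0// exprn_ile1// ltW.
have -> : (4 * T l) ^+ r * (8 * (a * delta * expR (- l%:R))) ^+ d =
   C * (a ^+ d) * ((q ^- l) ^+ r * expR (- l%:R) ^+ d) * (sigma ^+ r * delta ^+ d).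
  by rewrite /T /C !exprMn; ring.
rewrite sd mulr1; apply: ler_pM.
- by rewrite mulr_ge0// ?exprn_ge0// ltW.
- by rewrite mulr_ge0// exprn_ge0 ?expR_ge0// invr_ge0 exprn_ge0// ltW.
- rewrite ler_pM2l//; apply: ler_iXnr => //; exact: ltW.
rewrite qE.
apply: (@le_trans _ _ (q ^+ (l * r))).
  rewrite exprVn -!exprM ler_pdivrMl ?exprn_gt0// -exprD.
  apply: ler_wiXn2l; [exact: ltW|exact: ltW|].
  by rewrite (mulnC l r) addnn -mul2n mulnA leq_pmulr.
by apply: ler_wiXn2l; [exact: ltW|exact: ltW|rewrite leq_pmulr].
Qed.

(** * The lower bound for the transport cost *)

Lemma torus_dist_ge0 (R : realType) (d : nat) (x y : torus R d) : 0 <= torus_dist x y.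
Proof.
rewrite leNgt; apply/negP => /inf_lt [|_ [m _ <-]].
  by exists (enorm (repr x - repr y - 0)); exists 0 => //=; exact: rpred0.
by rewrite ltNge /enorm sqrtr_ge0.
Qed.

Theorem theorem7 (R : realType) (d r : nat) (hd : (1 <= d)%N) (hr : (1 <= r)%N)
    (alpha : 'I_r -> 'rV[R]_d) (B : R) (hB : 0 < B)
    (halpha : badly_approximable alpha) :
  exists2 c : R, 0 < c &
    forall (disp : measure_display) (Omega : measurableType disp)
      (P : probability Omega R)
      (xi : 'I_r -> Omega -> int) (I : Omega -> 'I_r)
      (mxi : forall i, discrete_rv (xi i)) (mI : discrete_rv I),
      mutually_independent P xi I ->
      (forall i, (P (I @^-1` [set i]) * 'E_P[fun w => ((xi i w)%:~R ^+ 2 : R)%R]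
                  <= B%:E)%E) ->
    forall mu : probability (torus R d) R, normalized_haar mu ->
    forall p : R, 0 < p <= 1 ->
    forall k : nat, (1 <= k)%N ->
      ((c * k%:R `^ (- (r%:R / (2 * d%:R))))%R%:E
       <= wasserstein p (convolution_pow (step_distribution P alpha mxi mI) k) mu
            `^ p^-1)%E.
Proof.
have [a a0 scale] := scale_choice R d r B hd hr hB.
exists (a * expR (- 1)); first by rewrite mulr_gt0 ?expR_gt0.
move=> disp Omega P xi I mxi mI indep moment mu hmu p hp k k1.
have p0 : 0 < p by case/andP: hp.
have kR1 : 1 <= k%:R :> R by rewrite ler1n.
have kR0 : 0 < k%:R :> R by apply: lt_le_trans kR1.
set delta := k%:R `^ _; pose sigma := k%:R `^ 2^-1 : R.
have delta0 : 0 < delta by exact: powR_gt0.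
have sigma1 : 1 <= sigma by rewrite -(powRr0 k%:R); apply: ler_powR; rewrite ?invr_ge0.
have sigma2 : sigma ^+ 2 = k%:R.
  by rewrite -powR_mulrn ?powR_ge0// -powRrM mulVf// powRr1// ltW.
have sigma_delta : sigma ^+ r * delta ^+ d = 1.
  rewrite -!powR_mulrn ?powR_ge0// -!powRrM -powRD; last by apply/implyP => _; rewrite gt_eqF.
  rewrite (_ : _ + _ = 0) ?powRr0//; field.
  by rewrite pnatr_eq0 -lt0n.
have [T T1 bsum] := scale sigma delta sigma1 delta0 sigma_delta.
have lower theta : coupling (convolution_pow (step_distribution P alpha mxi mI) k) mu theta ->
    (((a * delta * expR (- 1)) `^ p)%:E <= \int[theta]_z (torus_dist z.1 z.2 `^ p)%:E)%E.
  move=> cpl.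
  have s0 l : 0 < a * delta * expR (- l%:R) by rewrite !mulr_gt0 ?expR_gt0.
  have [G hG] := choice (fun l : nat => walk_near_pairs P alpha xi I mxi mI indep B
    moment k (T l) _ mu theta hmu cpl (T1 l) (s0 l)).
  apply: (integral_powR_ge theta (fun z => torus_dist z.1 z.2) (a * delta) p G
    (fun l => r%:R * (k%:R * B) / T l ^+ 2 +
      (4 * T l) ^+ r * (8 * (a * delta * expR (- l%:R))) ^+ d)) => //.
  - by move=> z; exact: torus_dist_ge0.
  - by rewrite mulr_gt0.
  - by move=> l; have [] := hG l.
  - by move=> l z; have [_ h _] := hG l; exact: h.
  - by move=> l; have [] := hG l.
  - by move=> n; have := bsum n; rewrite sigma2.
have -> : a * expR (- 1) * delta = ((a * delta * expR (- 1)) `^ p) `^ p^-1.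
  by rewrite -powRrM divff ?gt_eqF// powRr1 1?mulrAC// !mulr_ge0 ?expR_ge0 ?ltW.
rewrite -poweR_EFin; apply: gt0_ler_poweR; first by rewrite invr_ge0 ltW.
- by rewrite in_itv/= leey lee_fin powR_ge0.
- rewrite in_itv/= leey andbT; apply: le_ereal_inf_tmp => _ [theta _ <-].
  by apply: integral_ge0 => z _; rewrite lee_fin powR_ge0.
- by apply: le_ereal_inf_tmp => _ [theta cpl <-]; exact: lower.
Qed.
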